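(* Consider the online (unweighted) fractional set cover problem over $n$ sets, where covering constraints $\langle a_t, x\rangle \ge 1$ with $a_t\in\{0,1\}^n\setminus\{0\}$ arrive online, and let $P_t:=\{x\ge 0 : \langle a_s,x\rangle\ge 1\ \forall s\le t\}$. Define $x^0_i := 1/n$ for all $i$, and for $t\ge1$ \[ x^t := \arg\min_{x\in P_t} \sum_{i=1}^n \Big( x_i\log\frac{x_i}{x^{t-1}_i} - x_i + x^{t-1}_i\Big). \] Then for every $t$, $x^t\in P_t$, and the fractional solution uses at most $(\log n)\cdot OPT + 1$ sets, i.e., $\sum_i x^t_i \le (\log n)\cdot OPT_t + 1$, where $OPT_t$ is the number of sets in an optimal integer solution covering the first $t$ constraints.
   Context: Here $\log$ denotes the natural logarithm. An integer solution is a vector in $\{0,1\}^n\cap P_t$ and its number of sets is its $\ell_1$-norm. *)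

(* Defs.v *)
From mathcomp Require Import all_boot all_order all_algebra.
From mathcomp Require Import all_classical all_reals all_analysis.

Set Implicit Arguments.
Unset Strict Implicit.
Unset Printing Implicit Defensive.

Import Order.TTheory GRing.Theory Num.Theory.
Local Open Scope classical_set_scope.
Local Open Scope ring_scope.

Definition minimizers (R : realType) (T : Type) (f : T -> R) (A : set T) :
    set T :=
  [set x | A x /\ forall y, A y -> f x <= f y].

(* "The" minimizer: a definite description, equal to the junk value [x0] unless
   a minimizer exists and is unique. *)
Definition argmin (R : realType) (T : choiceType) (x0 : T) (f : T -> R)
    (A : set T) : T :=
  xget x0 [set x | minimizers f A = [set x]].

Definition dotp (R : realType) (n : nat) (u v : 'rV[R]_n) : R :=
  \sum_(i < n) u 0 i * v 0 i.

(* The canonical norm on 'rV[R]_n is the sup norm. *)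
Definition l1norm (R : realType) (n : nat) (x : 'rV[R]_n) : R :=
  \sum_(i < n) `|x 0 i|.

Definition zero_one (R : realType) (n : nat) : set 'rV[R]_n :=
  [set x : 'rV[R]_n | forall i, x 0 i = 0 \/ x 0 i = 1].
Arguments zero_one : clear implicits.

(* P_t; the constraints are a_1, a_2, ..., and the value [a 0] is not used. *)
Definition feasible (R : realType) (n : nat) (a : nat -> 'rV[R]_n) (t : nat) :
    set 'rV[R]_n :=
  [set x : 'rV[R]_n | (forall i, 0 <= x 0 i) /\
           (forall s : nat, (1 <= s <= t)%N -> 1 <= dotp (a s) x)].

(* The convention 0 log 0 = 0 holds because [ln 0 = 0]. *)
Definition relent (R : realType) (n : nat) (x y : 'rV[R]_n) : R :=
  \sum_(i < n) (x 0 i * ln (x 0 i / y 0 i) - x 0 i + y 0 i).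

(* For t >= 1 the junk value 0 of [argmin] is not in [feasible a t]. *)
Fixpoint online (R : realType) (n : nat) (a : nat -> 'rV[R]_n) (t : nat) :
    'rV[R]_n :=
  if t is t'.+1
  then argmin 0 (fun x => relent x (online a t')) (feasible a t)
  else const_mx (n%:R^-1).

(* The infimum is a minimum: {0,1}^n is finite, and the all-ones vector is
   feasible when the a_s are nonzero 0/1 vectors. *)
Definition OPT (R : realType) (n : nat) (a : nat -> 'rV[R]_n) (t : nat) : R :=
  inf [set l1norm z | z in zero_one R n `&` feasible a t].

(* Main.v *)
(** The relative entropy to a feasible [z] is a potential: projecting [x^{t-1}]
    onto the convex set [P_t] does not increase it (generalized Pythagorean
    inequality), so [relent z x^t <= relent z x^0 = k log n - k + 1] for a 0/1
    vector [z] in [P_t] with [k] ones.  As the constraints are 0/1, the iterates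
    stay in [(0, 1]], hence [relent z x^t >= \sum_i x^t_i - k]; the bound is the
    difference of the two.  The projection exists and is unique because clamping
    a competitor into the box [[x^{t-1}, 1]] keeps it feasible and does not
    increase the objective. *)

Require Import Defs.
From mathcomp Require Import all_boot all_order all_algebra.
From mathcomp Require Import all_classical all_reals all_analysis.
From mathcomp Require Import ring lra.

Set Implicit Arguments.
Unset Strict Implicit.

Import Order.TTheory GRing.Theory Num.Theory.
Import numFieldNormedType.Exports.
Local Open Scope classical_set_scope.
Local Open Scope ring_scope.

(** * Scalar relative entropy and its behaviour under clamping *)

Definition kl (R : realType) (s y : R) : R := s * ln (s / y) - s + y.

Lemma relentE (R : realType) (n : nat) (x y : 'rV[R]_n) :
  relent x y = \sum_(i < n) kl (x 0 i) (y 0 i).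
Proof. by []. Qed.

Lemma ln_le_sub1 (R : realType) (u : R) : 0 < u -> ln u <= u - 1.
Proof. by move=> u0; have := expR_ge1Dx (ln u); rewrite lnK //; lra. Qed.

Lemma ln_eq_sub1 (R : realType) (u : R) : 0 < u -> u - 1 <= ln u -> u = 1.
Proof.
move=> u0 h; apply/eqP; rewrite -ln_eq0 //; apply: contraT => lnu0.
by have := expR_gt1Dx lnu0; rewrite lnK //; lra.
Qed.

(** For [0 < s] this is [ln u <= u - 1] at [u = y / s], multiplied by [s]. *)
Lemma kl_ge0 (R : realType) (s y : R) : 0 <= s -> 0 < y -> 0 <= kl s y.
Proof.
rewrite /kl le_eqVlt => /predU1P[<-|s0] y0; first by lra.
have := ln_le_sub1 (divr_gt0 y0 s0).
rewrite -invf_div lnV ?posrE ?divr_gt0 // => h.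
have := ler_wpM2l (ltW s0) h.
by rewrite mulrBr invf_div mulrCA divff ?gt_eqF //; lra.
Qed.

Lemma kl_eq0 (R : realType) (s y : R) : 0 <= s -> 0 < y -> kl s y = 0 -> s = y.
Proof.
rewrite /kl le_eqVlt => /predU1P[<-|s0] y0; first by lra.
move=> h; suff ys1 : y / s = 1 by rewrite -[y](@divfK _ s) ?gt_eqF // ys1 mul1r.
apply: ln_eq_sub1; first exact: divr_gt0.
rewrite -[y / s]invf_div lnV ?posrE ?divr_gt0 // -(ler_pM2l s0).
by rewrite mulrBr invf_div mulrCA divff ?gt_eqF //; lra.
Qed.

(** Bregman three-point identity: [ln (c / y)] is the derivative of [kl ^~ y] at [c], and [kl s c]
    is the exact first-order remainder. *)
Lemma kl_three_point (R : realType) (s c y : R) : 0 <= s -> 0 < c -> 0 < y ->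
  kl s y = kl s c + kl c y + (s - c) * ln (c / y).
Proof.
rewrite /kl le_eqVlt => /predU1P[<-|s0] c0 y0; first by ring.
by rewrite !ln_div ?posrE //; ring.
Qed.

(** Follows from [ln u <= u - 1] at [u = s / y]. It makes the remainder along a segment quadratic in
    the step length. *)
Lemma kl_le_sqr (R : realType) (s y : R) : 0 <= s -> 0 < y ->
  kl s y <= (s - y) ^+ 2 / y.
Proof.
move=> s0 y0; have -> : (s - y) ^+ 2 / y = s * (s / y - 1) - s + y.
  by field; rewrite gt_eqF.
rewrite /kl lerD2r lerD2r; move: s0; rewrite le_eqVlt => /predU1P[<-|s0].
  by rewrite !mul0r.
by rewrite ler_pM2l // ln_le_sub1 // divr_gt0.
Qed.

Lemma kl_continuous (R : realType) (s y : R) : 0 < s -> 0 < y ->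
  {for s, continuous (fun u : R => kl u y)}.
Proof.
move=> s0 y0; rewrite /kl; apply: cvgD; last exact: cvg_cst.
apply: cvgB; last exact: cvg_id.
apply: cvgM; first exact: cvg_id.
apply: (@continuous_comp _ _ _ (fun u : R => u / y) (@ln R)).
  by apply: cvgM; [exact: cvg_id|exact: cvg_cst].
by apply: continuous_ln; rewrite divr_gt0.
Qed.

Definition clamp (R : realType) (l u s : R) : R := Num.min u (Num.max l s).

Lemma clamp_bounds (R : realType) (l u s : R) : l <= u ->
  l <= clamp l u s <= u.
Proof. by move=> lu; rewrite /clamp le_min ge_min lexx lu le_max lexx. Qed.

Lemma kl_clamp (R : realType) (y s : R) : 0 < y <= 1 -> 0 <= s ->
  kl (clamp y 1 s) y <= kl s y.
Proof.
move=> /andP[y0 y1] s0; have /andP[yc c1] := clamp_bounds s y1.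
have c0 := lt_le_trans y0 yc.
rewrite (kl_three_point s0 c0 y0).
have := kl_ge0 s0 c0.
(* With [c] the clamped value: if [s < y] then [c = y] and the logarithm vanishes; if [y <= s <= 1]
   then [s = c]; if [1 < s] then [c = 1] and both factors are nonnegative. *)
suff : 0 <= (s - clamp y 1 s) * ln (clamp y 1 s / y) by lra.
move: yc c1 c0; rewrite /clamp.
case: (leP y s) => [ys|sy]; last first.
  rewrite min_r // => _ _ _.
  by rewrite divff ?gt_eqF // ln1 mulr0.
case: (leP 1 s) => [s1|s1]; last by move=> *; rewrite subrr mul0r.
by move=> *; rewrite mulr_ge0 ?subr_ge0 // ln_ge0 // ler_pdivlMr // mul1r.
Qed.

(** * Relative entropy of vectors and the Pythagorean inequality *)

Lemma relent_ge0 (R : realType) (n : nat) (x y : 'rV[R]_n) :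
  (forall i, 0 <= x 0 i) -> (forall i, 0 < y 0 i) -> 0 <= relent x y.
Proof. by move=> x0 y0; apply: sumr_ge0 => i _; exact: kl_ge0. Qed.

Lemma relent_eq0 (R : realType) (n : nat) (x y : 'rV[R]_n) :
  (forall i, 0 <= x 0 i) -> (forall i, 0 < y 0 i) -> relent x y = 0 -> x = y.
Proof.
move=> x0 y0 /psumr_eq0P h; apply/rowP => i.
by apply: kl_eq0 => //; apply: h => // j _; exact: kl_ge0.
Qed.

Lemma relent_three_point (R : realType) (n : nat) (z x y : 'rV[R]_n) :
  (forall i, 0 <= z 0 i) -> (forall i, 0 < x 0 i) -> (forall i, 0 < y 0 i) ->
  relent z y = relent z x + relent x y +
               \sum_(i < n) (z 0 i - x 0 i) * ln (x 0 i / y 0 i).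
Proof.
move=> z0 x0 y0; rewrite !relentE -!big_split; apply: eq_bigr => i _ /=.
exact: kl_three_point.
Qed.

(* Minimality along the segment from [x] to [z] gives
   [0 <= e * g + e ^+ 2 * C] for all [0 < e <= 1], where [g] is the directional
   derivative of [relent ^~ y] at [x]; hence [0 <= g]. *)
Lemma relent_pythagoras (R : realType) (n : nat) (A : set 'rV[R]_n)
    (z x y : 'rV[R]_n) :
  (forall e, 0 < e <= 1 -> A (x + e *: (z - x))) ->
  (forall w, A w -> forall i, 0 <= w 0 i) ->
  A z -> (forall i, 0 < x 0 i) -> (forall i, 0 < y 0 i) ->
  minimizers (fun w => relent w y) A x ->
  relent z x + relent x y <= relent z y.
Proof.
move=> Aconv A0 Az x0 y0 [Ax xmin].
rewrite (relent_three_point (A0 _ Az) x0 y0) lerDl.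
set g := \sum_(i < n) _.
pose C : R := \sum_(i < n) (z 0 i - x 0 i) ^+ 2 / x 0 i.
have C0 : 0 <= C.
  by apply: sumr_ge0 => i _; rewrite divr_ge0 ?sqr_ge0 // ltW.
have seg e : 0 < e <= 1 -> 0 <= g + e * C.
  move=> e01; have Aw := Aconv e e01; have /andP[e0 e1] := e01.
  have wE i : (x + e *: (z - x)) 0 i = x 0 i + e * (z 0 i - x 0 i).
    by rewrite !mxE.
  (* Expanding at [x] leaves the linear term [e * g] and the remainder [relent w x], at most
     [e ^+ 2 * C]; dividing by [e] gives the claim. *)
  have := xmin _ Aw; rewrite (relent_three_point (A0 _ Aw) x0 y0).
  have -> : \sum_(i < n) ((x + e *: (z - x)) 0 i - x 0 i) * ln (x 0 i / y 0 i) =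
            e * g.
    rewrite /g mulr_sumr; apply: eq_bigr => i _; rewrite wE.
    by rewrite addrC addKr mulrA.
  have : relent (x + e *: (z - x)) x <= e * (e * C).
    rewrite /C !mulr_sumr; apply: ler_sum => i _.
    apply: le_trans (kl_le_sqr (A0 _ Aw i) (x0 i)) _.
    rewrite wE addrC addKr.
    by rewrite exprMn !mulrA -expr2.
  by move=> h1 h2; rewrite -(pmulr_rge0 _ e0) mulrDr; lra.
rewrite leNgt; apply/negP => g0.
have D0 : 0 < C - g by lra.
(* [e = -g / (C - g)] is in [(0, 1]] and [g + e * C = -g ^+ 2 / (C - g) < 0]. *)
have := seg (- g / (C - g)).
have -> : g + - g / (C - g) * C = - (g ^+ 2 / (C - g)).
  by field; rewrite gt_eqF.
rewrite oppr_ge0 divr_gt0 ?oppr_gt0 // ler_pdivrMr // mul1r.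
have -> : - g <= C - g by lra.
by move=> /(_ isT); rewrite leNgt divr_gt0 // exprn_even_gt0 //= lt_eqF.
Qed.

(** * Continuity of the objective; closedness and convexity of the constraints *)

Lemma relent_continuous (R : realType) (n : nat) (x y : 'rV[R]_n) :
  (forall i, 0 < x 0 i) -> (forall i, 0 < y 0 i) ->
  {for x, continuous (fun w : 'rV[R]_n => relent w y)}.
Proof.
move=> x0 y0; rewrite /prop_for /relent.
apply: (@cvg_big _ _ _ _ _ _ _ (nbhs x) _ _ _ (nbhs_filter x)) => [|i _].
  exact: add_continuous.
apply: (@continuous_comp _ _ _ (fun w : 'rV[R]_n => w 0 i)
  (fun u : R => kl u (y 0 i))).
  exact: coord_continuous.
exact: kl_continuous.
Qed.

Lemma dotp_continuous (R : realType) (n : nat) (u : 'rV[R]_n) :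
  continuous (dotp u).
Proof.
move=> x; rewrite /dotp.
apply: (@cvg_big _ _ _ _ _ _ _ (nbhs x) _ _ _ (nbhs_filter x)) => [|i _].
  exact: add_continuous.
by apply: cvgM; [exact: cvg_cst|exact: coord_continuous].
Qed.

Lemma closed_constraints (R : realType) (n : nat) (a : nat -> 'rV[R]_n) (t : nat) :
  closed [set x : 'rV[R]_n |
    forall s : nat, (1 <= s <= t)%N -> 1 <= dotp (a s) x].
Proof.
apply: (@closed_bigI _ _ [set s : nat | (1 <= s <= t)%N]
  (fun s => dotp (a s) @^-1` [set u : R | 1 <= u])) => s _.
apply: preimage_closed; last exact: closed_ge.
by move=> x _; exact: dotp_continuous.
Qed.

Lemma feasible_segment (R : realType) (n : nat) (a : nat -> 'rV[R]_n) (t : nat)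
    (x z : 'rV[R]_n) (e : R) :
  feasible a t x -> feasible a t z -> 0 < e <= 1 ->
  feasible a t (x + e *: (z - x)).
Proof.
move=> [x0 xt] [z0 zt] /andP[e0 e1]; split=> [i|s st].
  rewrite !mxE; have -> : x 0 i + e * (z 0 i - x 0 i) =
    (1 - e) * x 0 i + e * z 0 i by ring.
  by rewrite addr_ge0 // mulr_ge0 ?subr_ge0 // ltW.
have -> : dotp (a s) (x + e *: (z - x)) =
    (1 - e) * dotp (a s) x + e * dotp (a s) z.
  rewrite /dotp !mulr_sumr -big_split; apply: eq_bigr => i _ /=.
  by rewrite !mxE; ring.
have : 1 - e <= (1 - e) * dotp (a s) x by rewrite ler_peMr ?subr_ge0 ?xt.
have : e <= e * dotp (a s) z by rewrite ler_peMr ?zt // ltW.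
by lra.
Qed.

Lemma feasible_le (R : realType) (n : nat) (a : nat -> 'rV[R]_n) (t u : nat) :
  (t <= u)%N -> feasible a u `<=` feasible a t.
Proof.
move=> tu x [x0 xu]; split=> // s /andP[s1 st].
by apply: xu; rewrite s1 (leq_trans st).
Qed.

(** * Existence and uniqueness of the projection *)

Definition clampv (R : realType) (n : nat) (y x : 'rV[R]_n) : 'rV[R]_n :=
  \row_i clamp (y 0 i) 1 (x 0 i).

Section OnlineSetCover.
Context {R : realType} {n : nat}.
Implicit Types (x y z : 'rV[R]_n) (t : nat).
Variable a : nat -> 'rV[R]_n.
Hypothesis ha : forall s : nat, (1 <= s)%N -> zero_one R n (a s) /\ a s <> 0.

Lemma constraint_ge0 s i : (1 <= s)%N -> 0 <= a s 0 i.
Proof. by move=> /ha[+ _] => /(_ i)[] ->. Qed.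

Lemma dotp_ge1 s x i : (1 <= s)%N -> (forall j, 0 <= x 0 j) ->
  a s 0 i = 1 -> 1 <= x 0 i -> 1 <= dotp (a s) x.
Proof.
move=> s1 x0 ai xi; rewrite /dotp (bigD1 i) //= ai mul1r ler_wpDr //.
by apply: sumr_ge0 => j _; rewrite mulr_ge0 // constraint_ge0.
Qed.

Lemma feasible_ones t : feasible a t (const_mx 1).
Proof.
split=> [i|s /andP[s1 _]]; first by rewrite mxE.
have [a01 a0] := ha s1.
have [i ai] : exists i, a s 0 i = 1.
  apply: contrapT => /forallNP h; apply: a0; apply/rowP => i.
  by rewrite mxE; case: (a01 i) => // /h.
by apply: (dotp_ge1 s1 _ ai) => [j|]; rewrite mxE.
Qed.

(** Fix a constraint. If a coordinate in its support is at least 1, it is clamped to 1 and covers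
    the constraint alone; otherwise all coordinates in the support are below 1 and clamping can only
    raise them. *)
Lemma feasible_clampv t y x : (forall i, 0 < y 0 i <= 1) ->
  feasible a t x -> feasible a t (clampv y x).
Proof.
move=> y01 [x0 xt].
have c0 i : 0 <= clampv y x 0 i.
  rewrite mxE; have /andP[yi0 yi1] := y01 i.
  by have /andP[+ _] := clamp_bounds (x 0 i) yi1; apply: le_trans; exact: ltW.
split=> // s /andP[s1 st].
have [[i [ai xi]]|noi] := pselect (exists i, a s 0 i = 1 /\ 1 <= x 0 i).
  apply: (dotp_ge1 s1 c0 ai).
  by rewrite mxE /clamp le_min lexx le_max xi orbT.
apply: le_trans (xt s _) _; first by rewrite s1.
apply: ler_sum => i _; rewrite mxE.
have [-> | ai] := (ha s1).1 i; first by rewrite !mul0r.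
rewrite ai !mul1r /clamp le_min le_max lexx orbT andbT leNgt.
by apply/negP => /ltW xi; apply: noi; exists i.
Qed.

Lemma relent_clampv y x : (forall i, 0 < y 0 i <= 1) -> (forall i, 0 <= x 0 i) ->
  relent (clampv y x) y <= relent x y.
Proof. by move=> y01 x0; apply: ler_sum => i _; rewrite mxE; exact: kl_clamp. Qed.

(* Clamping a competitor into the box [[y, 1]] does not increase [relent _ y],
   so it is enough to minimize over a compact set of positive vectors, where
   [relent _ y] is continuous. *)
Lemma minimizer_exists t y : (forall i, 0 < y 0 i <= 1) ->
  exists2 x, minimizers (fun w => relent w y) (feasible a t) x &
    forall i, 0 < x 0 i <= 1.
Proof.
move=> y01.
pose box : set 'rV[R]_n := [set x | forall i, `[y 0 i, 1]%classic (x 0 i)].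
pose B := box `&` [set x | forall s : nat, (1 <= s <= t)%N -> 1 <= dotp (a s) x].
have boxP x : box x -> forall i, 0 < x 0 i <= 1.
  move=> bx i; have := bx i; rewrite /= in_itv /= => /andP[yx ->].
  by have /andP[yi0 _] := y01 i; rewrite (lt_le_trans yi0).
have BP x : B x -> feasible a t x.
  by move=> [/boxP bx xt]; split => // i; have /andP[/ltW] := bx i.
have Bclamp x : feasible a t x -> B (clampv y x).
  move=> /(feasible_clampv y01)[_ xt]; split=> // i.
  by rewrite /= mxE in_itv /=; apply: clamp_bounds; have /andP[] := y01 i.
have [|||x] := @EVT_min_rV R n (fun w => relent w y) B.
- by exists (clampv y (const_mx 1)); apply: Bclamp; exact: feasible_ones.
- apply: compact_closedI; last exact: closed_constraints.
  by apply: (@rV_compact R n (fun i => `[y 0 i, 1]%classic)) => i;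
    exact: segment_compact.
- apply: continuous_in_subspaceT => x /set_mem[/boxP bx _].
  by apply: relent_continuous => i; [have /andP[] := bx i|have /andP[] := y01 i].
- move=> /set_mem Bx xmin; exists x; last exact: boxP Bx.1.
  split; [exact: BP|move=> z fz].
  apply: le_trans (relent_clampv y01 fz.1).
  by apply: xmin; apply/mem_set; exact: Bclamp.
Qed.

(** The Pythagorean inequality serves twice: it makes the minimizer unique, so that [argmin] is not
    its default value, and it makes the potential nonincreasing. *)
Lemma argmin_projection t y : (forall i, 0 < y 0 i <= 1) ->
  let x := argmin 0 (fun w => relent w y) (feasible a t) in
  [/\ feasible a t x, forall i, 0 < x 0 i <= 1 &
      forall z, feasible a t z -> relent z x <= relent z y].
Proof.
move=> y01.
have [x xmin x01] := minimizer_exists t y01.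
have x0 i : 0 < x 0 i by have /andP[] := x01 i.
have y0 i : 0 < y 0 i by have /andP[] := y01 i.
have pyth z : feasible a t z -> relent z x + relent x y <= relent z y.
  move=> fz; apply: (relent_pythagoras _ _ fz x0 y0 xmin).
  - by move=> e; exact: feasible_segment xmin.1 fz.
  - by move=> w [].
have minE : minimizers (fun w => relent w y) (feasible a t) = [set x].
  apply/seteqP; split=> [z [fz zmin]|z ->] //=.
  (* A second minimizer [z] has [relent z y <= relent x y], so the Pythagorean inequality forces
     [relent z x <= 0]. *)
  apply: relent_eq0 => //; first exact: fz.1.
  have := pyth z fz; have := zmin x xmin.1.
  by have := relent_ge0 fz.1 x0; lra.
have -> : argmin 0 (fun w => relent w y) (feasible a t) = x.
  apply: xget_unique => // z; rewrite /= minE => xz.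
  by have : [set z] z by []; rewrite -xz.
split=> //; first exact: xmin.1.
move=> z fz; apply: le_trans (pyth z fz); rewrite lerDl.
by apply: relent_ge0 => // i; exact: ltW.
Qed.

(** * The potential argument and the competitive bound *)

Lemma dim_gt0 : (0 < n)%N.
Proof.
rewrite lt0n; apply/eqP => n0; have [_] := ha (leqnn 1); apply.
by apply/rowP => i; have := ltn_ord i; rewrite [X in (_ < X)%N]n0.
Qed.

(** The potential bound passes through the induction because the feasible sets shrink: a [z]
    satisfying the first [t.+1] constraints is a valid competitor at all earlier times. *)
Lemma online_invariant t :
  [/\ feasible a t (online a t), forall i, 0 < online a t 0 i <= 1 &
      forall z, feasible a t z ->
        relent z (online a t) <= relent z (const_mx n%:R^-1)].
Proof.
elim: t => [|t [ft xt IH]].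
  split=> [|i|//].
  - by split=> [i|[|s]] //=; rewrite mxE invr_ge0.
  - by rewrite mxE invr_gt0 ltr0n dim_gt0 invf_le1 ?ltr0n ?ler1n ?dim_gt0.
have [fx x01 le_x] := argmin_projection t.+1 xt.
split=> // z fz; apply: le_trans (le_x z fz) _.
by apply: IH; exact: feasible_le fz.
Qed.

(* For a 0/1 vector [z] with [k] ones, [relent z x] is
   [\sum_(i | z i = 1) - ln (x i) - k + \sum_i x i], and [- ln (x i) >= 0]. *)
Lemma online_le_integral t z : zero_one R n z -> feasible a t z ->
  \sum_(i < n) online a t 0 i <= ln n%:R * l1norm z + 1.
Proof.
move=> z01 fz; have [_ x01 /(_ z fz)] := online_invariant t.
have n0 : (0 : R) < n%:R by rewrite ltr0n dim_gt0.
have zE : l1norm z = \sum_(i < n) z 0 i.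
  by apply: eq_bigr => i _; rewrite ger0_norm // fz.1.
have -> : relent z (const_mx n%:R^-1) = ln n%:R * l1norm z - l1norm z + 1.
  have sum1 : \sum_(i < n) n%:R^-1 = 1 :> R.
    by rewrite sumr_const card_ord -[LHS]mulr_natr mulVf ?gt_eqF.
  rewrite zE -[X in _ = _ + X]sum1 mulr_sumr -sumrB -big_split; apply: eq_bigr => i _ /=.
  by rewrite mxE invrK; have [->|->] := z01 i; rewrite ?mul0r ?mulr0 ?mul1r ?mulr1.
have : \sum_(i < n) (online a t 0 i - z 0 i) <= relent z (online a t).
  apply: ler_sum => i _; have [->|->] := z01 i; first by rewrite mul0r; lra.
  have /andP[xi0 xi1] := x01 i.
  have : 0 <= ln (1 / online a t 0 i).
    by rewrite ln_ge0 // ler_pdivlMr // mul1r.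
  by lra.
by rewrite sumrB -zE; lra.
Qed.

Lemma online_le_OPT t :
  \sum_(i < n) online a t 0 i <= ln n%:R * OPT a t + 1.
Proof.
have ones : (zero_one R n `&` feasible a t) (const_mx 1).
  by split; [move=> i; rewrite mxE; right|exact: feasible_ones].
have : (1 : R) <= n%:R by rewrite ler1n dim_gt0.
(* Passing to the infimum divides by [ln n%:R], which is zero for [n = 1]; there the all-ones cover
   already gives the bound 1. *)
rewrite le_eqVlt => /predU1P[n1|/ln_gt0 ln0].
  by have := online_le_integral ones.1 ones.2; rewrite -n1 ln1 !mul0r.
rewrite -lerBlDr mulrC -ler_pdivrMr //; apply: lb_le_inf.
  by exists (l1norm (const_mx 1 : 'rV[R]_n)), (const_mx 1).
move=> _ [z [z01 fz] <-]; rewrite ler_pdivrMr // mulrC lerBlDr.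
exact: online_le_integral.
Qed.

End OnlineSetCover.

Unset Implicit Arguments.
Set Strict Implicit.

Theorem mainTheorem5 (R : realType) (n : nat) (a : nat -> 'rV[R]_n)
    (ha : forall s : nat, (1 <= s)%N -> zero_one R n (a s) /\ a s <> 0)
    (t : nat) :
  feasible a t (online a t) /\
  \sum_(i < n) online a t 0 i <= ln n%:R * OPT a t + 1.
Proof.
by split; [have [] := online_invariant ha t|exact: online_le_OPT].
Qed.
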